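(* Let $(X,T)$ be a minimal topological dynamical system and let $\pi: X\to X_D$ be the factor map onto its maximal distal factor. Then the following conditions are equivalent: (1) $(X,T)$ is strongly $\mathcal{F}_{ip}$-sensitive; (2) there is $\delta>0$ such that for every non-empty open subset $U$ of $X$ there exists a proximal pair $(x,y)$ with $x\in U$ and $d(x,y)>\delta$; (3) $\pi$ is not almost one-to-one.
   Context: A topological dynamical system $(X,T)$: compact metric space $(X,d)$, $T$ continuous surjective; minimal means every orbit is dense. A pair $(x,y)$ is proximal if $\inf_n d(T^nx,T^ny)=0$, otherwise distal; a system is distal if all pairs of distinct points are distal. The maximal distal factor $X_D$ is the distal factor of which every distal factor of $(X,T)$ is a factor (equivalently the quotient by the smallest closed invariant equivalence relation containing the proximal relation). An IP-set is a set containing $FS((p_i)_{i=1}^\infty)=\{\sum_{i\in\alpha}p_i:\alpha\subset\mathbb{N}$ finite nonempty$\}$ for some $p_i\in\mathbb{N}$; $\mathcal{F}_{ip}$ is the family of subsets of $\mathbb{Z}_+$ containing an IP-set. For a family $\mathcal{F}$, $(X,T)$ is strongly $\mathcal{F}$-sensitive if there is $\delta>0$ such that for each nonempty open $U$ there are $x,y\in U$ with $\{n\in\mathbb{Z}_+: d(T^nx,T^ny)>\delta\}\in\mathcal{F}$. A factor map $\pi$ is almost one-to-one if $\{x:\pi^{-1}(\pi(x))=\{x\}\}$ is dense. *)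

(* Defs.v *)
From Stdlib Require Import Reals List.
Open Scope R_scope.

Section Dyn.
Variables (X : Type) (d : X -> X -> R).

Definition is_metric : Prop :=
  (forall x y, 0 <= d x y) /\
  (forall x y, d x y = 0 <-> x = y) /\
  (forall x y, d x y = d y x) /\
  (forall x y z, d x z <= d x y + d y z).

Definition metric_open (U : X -> Prop) : Prop :=
  forall x, U x -> exists e, 0 < e /\ forall y, d x y < e -> U y.

Definition compact_space : Prop :=
  forall (I : Type) (U : I -> X -> Prop),
    (forall i, metric_open (U i)) -> (forall x, exists i, U i x) ->
    exists l : list I, forall x, exists i, In i l /\ U i x.

Definition compact_metric_space : Prop := is_metric /\ compact_space.

Definition continuous_map (T : X -> X) : Prop :=
  forall x e, 0 < e -> exists del, 0 < del /\
    forall y, d x y < del -> d (T x) (T y) < e.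

Definition surjective_map (T : X -> X) : Prop := forall y, exists x, T x = y.

Definition metric_dense (A : X -> Prop) : Prop :=
  forall U, metric_open U -> (exists u, U u) -> exists x, U x /\ A x.

Definition itr (T : X -> X) (n : nat) (x : X) : X := Nat.iter n T x.

Definition minimal (T : X -> X) : Prop :=
  forall x, metric_dense (fun z => exists n, z = itr T n x).

(* proximal: inf_n d(T^n x, T^n y) = 0 (d >= 0, so the infimum is 0 iff
   it is approached arbitrarily closely) *)
Definition proximal (T : X -> X) (x y : X) : Prop :=
  forall e, 0 < e -> exists n, d (itr T n x) (itr T n y) < e.

Definition closed_rel (Rl : X -> X -> Prop) : Prop :=
  forall x y, ~ Rl x y -> exists e, 0 < e /\
    forall x' y', d x x' < e -> d y y' < e -> ~ Rl x' y'.

Definition invariant_rel (T : X -> X) (Rl : X -> X -> Prop) : Prop :=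
  forall x y, Rl x y -> Rl (T x) (T y).

Definition equiv_rel (Rl : X -> X -> Prop) : Prop :=
  (forall x, Rl x x) /\ (forall x y, Rl x y -> Rl y x) /\
  (forall x y z, Rl x y -> Rl y z -> Rl x z).

(* the smallest closed invariant equivalence relation containing the
   proximal relation; X_D = X / distal_rel and pi is the quotient map *)
Definition distal_rel (T : X -> X) (x y : X) : Prop :=
  forall Rl : X -> X -> Prop,
    equiv_rel Rl -> closed_rel Rl -> invariant_rel T Rl ->
    (forall a b, proximal T a b -> Rl a b) -> Rl x y.

(* pi : X -> X_D is almost one-to-one iff
   {x | pi^{-1}(pi x) = {x}} = {x | the distal_rel-class of x is {x}} is metric_dense *)
Definition pi_almost_one_to_one (T : X -> X) : Prop :=
  metric_dense (fun x => forall y, distal_rel T x y -> y = x).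

End Dyn.
Arguments is_metric {X}. Arguments metric_open {X}. Arguments compact_space {X}. Arguments compact_metric_space {X}. Arguments continuous_map {X}. Arguments surjective_map {X}. Arguments metric_dense {X}. Arguments itr {X}. Arguments minimal {X}. Arguments proximal {X}. Arguments closed_rel {X}. Arguments invariant_rel {X}. Arguments equiv_rel {X}. Arguments distal_rel {X}. Arguments pi_almost_one_to_one {X}.

(* sum_{i in alpha} p_i, for alpha given as a duplicate-free list *)
Definition sum_over (p : nat -> nat) (alpha : list nat) : nat :=
  fold_right (fun i acc => (p i + acc)%nat) 0%nat alpha.

Definition F_ip (S : nat -> Prop) : Prop :=
  exists p : nat -> nat, (forall i, (0 < p i)%nat) /\
    forall alpha : list nat, alpha <> nil -> NoDup alpha -> S (sum_over p alpha).

Definition strongly_sensitive {X : Type} (d : X -> X -> R) (T : X -> X)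
  (F : (nat -> Prop) -> Prop) : Prop :=
  exists del, 0 < del /\ forall U, metric_open d U -> (exists u, U u) ->
    exists x y, U x /\ U y /\ F (fun n => d (itr T n x) (itr T n y) > del).

(* Main.v *)
Require Import Defs.
From Stdlib Require Import Reals List Lra Lia.
From mathcomp Require Import ssreflect ssrfun ssrbool boolp classical_sets filter.
Open Scope R_scope.

(** (1) => (2): an idempotent ultrafilter [p] containing the given IP-set moves
    [x], [y] to points [px], [py] at distance at least [delta], and idempotence
    makes [(x, px)] and [(y, py)] proximal.  (2) => (1): if [(x, y)] is proximal,
    then along some IP-set both [T^n x] and [T^n y] return to [y]; hence so does
    [T^n T^k y] to [T^k y], and [k] can be chosen with [T^k y] close to [x].
    (2) => (3): the classes of the distal relation shrink near a singleton class.
    (3) => (2): if (2) fails then, since [T] is semi-open, it fails inside every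
    open set and at every scale, so some [x0] has the property that everything
    proximal to a point near [x0] is itself near [x0].  Moving pairs close to
    [x0] by minimality shows that the proximal relation is a closed equivalence
    relation.  So it is the distal relation, and the classes along the orbit of
    [x0] are singletons. *)

Set Implicit Arguments.
Unset Strict Implicit.
Local Open Scope classical_set_scope.

(** * Addition of filters on the naturals and idempotent ultrafilters *)

Lemma proper_filter_setC (T : Type) (F : set_system T) (A : set T) :
  ProperFilter F -> F A -> ~ F (~` A).
Proof.
move=> FF FA FAC; apply: (filter_not_empty F).
by rewrite -(setICr A); exact: filterI.
Qed.

(** On ultrafilters this is the semigroup operation of the Stone-Cech compactification. If a filter
    [F] stands for the closed set [C] of ultrafilters above it, [filter_add F p] stands for
    [C + p]. *)
Definition filter_add (F G : set_system nat) : set_system nat :=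
  fun A => F (fun n => G (fun m => A (n + m)%nat)).

Lemma filter_addA (F G H : set_system nat) :
  filter_add (filter_add F G) H = filter_add F (filter_add G H).
Proof.
rewrite /filter_add; apply: funext => A; congr F; apply: funext => n.
congr G; apply: funext => m; congr H; apply: funext => k.
by rewrite Nat.add_assoc.
Qed.

Lemma filter_add_proper (F G : set_system nat) :
  ProperFilter F -> ProperFilter G -> ProperFilter (filter_add F G).
Proof.
move=> FF GF; split.
  by case/(@filter_ex _ F FF) => n; exact: filter_not_empty.
split.
- apply: (@filterS _ F _ setT) filterT => n _; exact: filterT.
- move=> A B FA FB; apply: (@filterS _ F) (@filterI _ F _ _ _ FA FB) => n [].
  exact: filterI.
- move=> A B AB; apply: (@filterS _ F) => n; apply: filterS => m; exact: AB.
Qed.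

Lemma ultra_sub_eq (p q : set_system nat) :
  UltraFilter p -> ProperFilter q -> p `<=` q -> p = q.
Proof. by move=> pU qF pq; rewrite (max_filter (F := p) qF pq). Qed.

Lemma filter_add_ultra (p q : set_system nat) :
  UltraFilter p -> UltraFilter q -> UltraFilter (filter_add p q).
Proof.
move=> pU qU; have pqF : ProperFilter (filter_add p q) by exact: filter_add_proper.
split=> // G GF sG; apply/seteqP; split=> // A GA.
case: (in_ultra_setVsetC (F := p) (fun n => q (fun m => A (n + m)%nat)) pU) => // pC.
have : G (~` A).
  apply: sG; apply: filterS pC => n nq.
  by case: (in_ultra_setVsetC (F := q) (fun m => A (n + m)%nat) qU).
by move=> GAC; case: (proper_filter_setC GF GA GAC).
Qed.

Lemma ultra_meet (F G : set_system nat) :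
  Filter F -> Filter G -> (forall A B, F A -> G B -> A `&` B !=set0) ->
  exists p, [/\ UltraFilter p, F `<=` p & G `<=` p].
Proof.
move=> FF GF FG.
pose H : set_system nat := fun C => exists A B, [/\ F A, G B & A `&` B `<=` C].
have HF : ProperFilter H.
  split.
    by case=> A [B [FA GB AB]]; have [n /AB] := FG A B FA GB.
  split.
  - by exists setT, setT; split; [exact: filterT|exact: filterT|].
  - move=> P Q [A [B [FA GB AB]]] [A' [B' [FA' GB' AB']]].
    exists (A `&` A'), (B `&` B'); split; [exact: filterI|exact: filterI|].
    by move=> n [[An A'n] [Bn B'n]]; split; [apply: AB|apply: AB'].
  - move=> P Q PQ [A [B [FA GB AB]]]; exists A, B; split=> //.
    exact: subset_trans PQ.
have [p [pU Hp]] := ultraFilterLemma HF.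
exists p; split=> // A ?; apply: Hp.
  by exists A, setT; split; [|exact: filterT|exact: subIsetl].
by exists setT, A; split; [exact: filterT| |exact: subIsetr].
Qed.

(** If [A] were not in [F], every member of [F] would meet the complement of [A], and some
    ultrafilter above [F] would contain that complement. *)
Lemma filter_ultraP (F : set_system nat) (A : set nat) :
  Filter F -> (forall p, UltraFilter p -> F `<=` p -> p A) -> F A.
Proof.
move=> FF H; apply: contrapT => nFA.
have AF : Filter (fun B => ~` A `<=` B).
  split=> // [P Q AP AQ n An|P Q PQ AP]; last exact: subset_trans PQ.
  by split; [apply: AP|apply: AQ].
have [|p [pU Fp Ap]] := ultra_meet FF AF.
  move=> B C FB AC; apply: contrapT => B0; apply: nFA.
  apply: filterS FB => n Bn; apply: contrapT => An.
  by apply: B0; exists n; split=> //; apply: AC.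
have pA := H p pU Fp.
exact: (proper_filter_setC (F := p) ultra_proper pA (Ap _ (@subset_refl _ _))).
Qed.

(** [q] has to contain [F] and, for each [B] in [r], the set of [n] with [B - n] in [p]. If such a
    set missed a member of [F], the complement of [B] would lie in [filter_add F p], hence in
    [r]. *)
Lemma ultra_translateP (F p r : set_system nat) :
  ProperFilter F -> UltraFilter p -> UltraFilter r -> filter_add F p `<=` r ->
  exists q, [/\ UltraFilter q, F `<=` q & r = filter_add q p].
Proof.
move=> FF pU rU Fpr.
pose G : set_system nat := fun C =>
  exists2 B, r B & (fun n => p (fun m => B (n + m)%nat)) `<=` C.
have GF : Filter G.
  split.
  - by exists setT => //; exact: filterT.
  - move=> P Q [A rA AP] [B rB BQ]; exists (A `&` B); first exact: filterI.
    by move=> n pn; split; [apply: AP|apply: BQ]; apply: filterS pn => m [].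
  - by move=> P Q PQ [B rB BP]; exists B => //; exact: subset_trans PQ.
have [|q [qU Fq Gq]] := ultra_meet FF GF.
  move=> A C FA [B rB BC]; apply: contrapT => AC0.
  have : r (~` B).
    apply: Fpr; apply: filterS FA => n An.
    case: (in_ultra_setVsetC (F := p) (fun m => B (n + m)%nat) pU) => // pB.
    by exfalso; apply: AC0; exists n; split=> //; apply: BC.
  by move=> rBC; case: (proper_filter_setC ultra_proper rB rBC).
exists q; split=> //; apply: ultra_sub_eq; first exact: filter_add_proper.
by move=> B rB; apply: Gq; exists B.
Qed.

(* The ultrafilters containing [F] form a closed subset of the Stone-Cech
   compactification of nat; this says that it is a subsemigroup. *)
Definition subsemigroup_filter (F : set_system nat) : Prop :=
  forall p q, UltraFilter p -> UltraFilter q -> F `<=` p -> F `<=` q ->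
  F `<=` filter_add p q.

(** A larger filter is a smaller closed set, so Zorn's lemma yields a minimal closed
    subsemigroup. *)
Lemma maximal_subsemigroup_filter (F0 : set_system nat) :
  ProperFilter F0 -> subsemigroup_filter F0 ->
  exists F, [/\ ProperFilter F, subsemigroup_filter F, F0 `<=` F &
    forall G, ProperFilter G -> subsemigroup_filter G -> F `<=` G -> G = F].
Proof.
move=> FF0 sF0.
pose good (F : set_system nat) :=
  [/\ ProperFilter F, subsemigroup_filter F & F0 `<=` F].
(* The alternative [F = set0] covers the empty chain, whose union is empty. *)
have [|F [PF maxF]] := @Zorn_bigcup _ (fun F => F = set0 \/ good F).
  move=> C CP Ctot.
  have [[F [CF gF]]|nC] := pselect (exists F, C F /\ good F); last first.
    left; apply/seteqP; split=> // A [F CF FA]; case: (CP F CF) => [F0E|gF].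
      by rewrite F0E in FA.
    by case: nC; exists F.
  have CG G A : C G -> G A -> good G.
    by move=> /CP[->|].
  right; have [FF sF F0F] := gF; split.
  - split.
      by case=> G CG0 GA; have [GF _ _] := CG _ _ CG0 GA; exact: (filter_not_empty G GA).
    split.
    + by exists F => //; exact: filterT.
    + move=> A B [G CG0 GA] [H CH HB]; have [GF _ _] := CG _ _ CG0 GA.
      have [HF _ _] := CG _ _ CH HB; case: (Ctot G H CG0 CH) => [GH|HG].
        by exists H => //; apply: filterI => //; apply: GH.
      by exists G => //; apply: filterI => //; apply: HG.
    + move=> A B AB [G CG0 GA]; have [GF _ _] := CG _ _ CG0 GA.
      by exists G => //; exact: filterS GA.
  - move=> p q pU qU Cp Cq A [G CG0 GA]; have [_ sG _] := CG _ _ CG0 GA.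
    by apply: (sG p q) => // B GB; [apply: Cp|apply: Cq]; exists G.
  - by move=> A F0A; exists F => //; apply: F0F.
have gF : good F.
  case: PF => // FE; exfalso; apply: (maxF F0); last by right; split.
  rewrite FE; split=> // /(_ setT) H; apply: H; exact: filterT.
have [FF sF F0F] := gF; exists F; split=> // G GF sG FG.
apply: contrapT => neq; apply: (maxF G); last by right; split=> // A /F0F /FG.
by split=> // GF'; apply: neq; apply/seteqP.
Qed.

(* Ellis-Numakura: for a minimal closed subsemigroup [C] and [p] in [C], both
   [C + p] and [{q in C | q + p = p}] are closed subsemigroups, hence equal [C]. *)
Lemma idempotent_ultrafilter (F0 : set_system nat) :
  ProperFilter F0 -> subsemigroup_filter F0 ->
  exists p, [/\ UltraFilter p, F0 `<=` p & filter_add p p = p].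
Proof.
move=> FF0 sF0.
have [F [FF sF F0F maxF]] := maximal_subsemigroup_filter FF0 sF0.
have [p [pU Fp]] := ultraFilterLemma FF.
have FpE : filter_add F p = F.
  apply: maxF; first exact: filter_add_proper.
  - move=> r1 r2 r1U r2U.
    move=> /(ultra_translateP FF pU r1U)[q1 [q1U Fq1 ->]].
    move=> /(ultra_translateP FF pU r2U)[q2 [q2U Fq2 ->]] A FpA.
    rewrite -filter_addA; apply: (sF _ q2) FpA => //.
      exact: filter_add_ultra.
    exact: sF.
  - by move=> A FA; apply: (@filter_ultraP F) => q qU Fq; exact: (sF q p).
(* As [filter_add F p = F] is contained in [p], some [q] above [F] has [q + p = p]. *)
have [|q [qU Fq qp]] := @ultra_translateP F p p FF pU pU.
  by rewrite FpE.
(* [H] stands for the closed set of all such [q]; the [q] just found makes it proper. *)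
pose H : set_system nat := fun C => exists A B, [/\ F A, p B &
  A `&` (fun n => p (fun m => B (n + m)%nat)) `<=` C].
have HE : H = F.
  apply: maxF.
  - split.
      case=> A [B [FA pB AB]]; rewrite qp in pB.
      by have [n /AB] := filter_ex (filterI (Fq _ FA) pB).
    split.
    + by exists setT, setT; split=> //; exact: filterT.
    + move=> P Q [A [B [FA pB AB]]] [A' [B' [FA' pB' AB']]].
      exists (A `&` A'), (B `&` B'); split; [exact: filterI|exact: filterI|].
      move=> n [[An A'n] pn]; split; [apply: AB|apply: AB']; split=> //;
        by apply: filterS pn => m [].
    + move=> P Q PQ [A [B [FA pB AB]]]; exists A, B; split=> //.
      exact: subset_trans PQ.
  - move=> r s rU sU Hr Hs.
    have HF r' : H `<=` r' -> F `<=` r'.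
      move=> Hr' A FA; apply: Hr'; exists A, setT; split=> //; exact: filterT.
    have Hp r' : UltraFilter r' -> H `<=` r' -> p = filter_add r' p.
      move=> r'U Hr'; apply: ultra_sub_eq; first exact: filter_add_proper.
      move=> B pB; apply: Hr'; exists setT, B; split=> //; exact: filterT.
    have rsU := filter_add_ultra rU sU.
    move=> C [A [B [FA pB AB]]]; apply: filterS AB _; apply: filterI.
      exact: (sF r s rU sU (HF _ Hr) (HF _ Hs)).
    suff : filter_add (filter_add r s) p B by [].
    by rewrite filter_addA -(Hp s) // -(Hp r).
  - move=> A FA; exists A, setT; split=> //; exact: filterT.
exists p; split=> //; first by move=> A /F0F /Fp.
apply/esym/ultra_sub_eq; first exact: filter_add_proper.
move=> B pB; apply: Fp; rewrite -HE; exists setT, B; split=> //; exact: filterT.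
Qed.

(** * IP-sets belong to idempotent ultrafilters *)

(** Tails are needed for the semigroup property: two sums from [s] may share an index, but the
    second can be taken from a tail beyond the indices of the first. *)
Definition IP_filter (s : nat -> nat) : set_system nat :=
  fun A => exists k, forall alpha, alpha <> nil -> NoDup alpha ->
    (forall i, In i alpha -> (k <= i)%nat) -> A (sum_over s alpha).

Lemma IP_filter_proper s : ProperFilter (IP_filter s).
Proof.
split.
  case=> k /(_ (k :: nil)); apply=> //; last by move=> i [<-|[]].
  by constructor; [|constructor].
split.
- by exists 0%nat.
- move=> A B [k kA] [l lB]; exists (Nat.max k l) => alpha ne nd ge.
  by split; [apply: kA|apply: lB] => // i /ge; lia.
- by move=> A B AB [k kA]; exists k => alpha ne nd ge; apply/AB/kA.
Qed.

Lemma sum_over_app s l l' :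
  sum_over s (l ++ l')%list = (sum_over s l + sum_over s l')%nat.
Proof. by elim: l => //= i l ->; rewrite Nat.add_assoc. Qed.

Lemma IP_filter_subsemigroup s : subsemigroup_filter (IP_filter s).
Proof.
move=> p q pU qU Fp Fq A [k kA]; apply: Fp; exists k => alpha ne nd ge.
apply: Fq; exists (Nat.max k (S (list_max alpha))) => beta ne' nd' ge'.
rewrite -sum_over_app; apply: kA.
- by case: alpha ne {nd ge ge'}.
- apply: NoDup_app => // i ia ib.
  have /Forall_forall/(_ _ ia) := proj1 (list_max_le alpha _) (Nat.le_refl _).
  by have := ge' _ ib; lia.
- by move=> i /in_app_iff[/ge //|/ge']; lia.
Qed.

Lemma IP_idempotent (s : nat -> nat) : exists p : set_system nat,
  [/\ UltraFilter p, filter_add p p = p &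
    forall A : set nat, (forall alpha, alpha <> nil -> NoDup alpha -> A (sum_over s alpha)) -> p A].
Proof.
have [p [pU Fp pp]] := idempotent_ultrafilter (IP_filter_proper s) (@IP_filter_subsemigroup s).
by exists p; split=> // A HA; apply: Fp; exists 0%nat => alpha ne nd _; exact: HA.
Qed.

Lemma inv_INR_S_pos n : 0 < / INR (S n).
Proof. exact/Rinv_0_lt_compat/lt_0_INR/Nat.lt_0_succ. Qed.

Lemma inv_INR_S_small e : 0 < e ->
  exists N, forall n, (N <= n)%nat -> / INR (S n) < e.
Proof.
move=> e0; have [N [HN N0]] := archimed_cor1 _ e0; exists N => n Nn.
apply: Rle_lt_trans HN; apply: Rinv_le_contravar; first exact: lt_0_INR.
by apply: le_INR; lia.
Qed.

(** * Compact metric spaces *)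

Section CompactMetric.
Variables (X : Type) (d : X -> X -> R).
Hypothesis HX : compact_metric_space d.

Lemma dist_ge0 x y : 0 <= d x y.
Proof. by case: HX => -[]. Qed.

Lemma dist_refl x : d x x = 0.
Proof. by case: HX => -[_ [H _]] _; apply/H. Qed.

Lemma dist_eq0 x y : d x y = 0 -> x = y.
Proof. by case: HX => -[_ [H _]] _ /H. Qed.

Lemma dist_sym x y : d x y = d y x.
Proof. by case: HX => -[_ [_ [H _]]] _. Qed.

Lemma dist_tri y x z : d x z <= d x y + d y z.
Proof. by case: HX => -[_ [_ [_ H]]] _. Qed.

Lemma ball_open x r : metric_open d (fun y => d x y < r).
Proof.
move=> y yr; exists (r - d x y); split; first lra.
by move=> z yz; have := dist_tri y x z; lra.
Qed.

Lemma preimage_open f (U : X -> Prop) :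
  continuous_map d f -> metric_open d U -> metric_open d (fun x => U (f x)).
Proof.
move=> fc Uo x /Uo[e [e0 He]]; have [r [r0 Hr]] := fc x e e0.
by exists r; split=> // y /Hr /He.
Qed.

Lemma open_and (U V : X -> Prop) :
  metric_open d U -> metric_open d V -> metric_open d (fun x => U x /\ V x).
Proof.
move=> Uo Vo x [/Uo[e [e0 He]] /Vo[r [r0 Hr]]].
exists (Rmin e r); split; first exact: Rmin_glb_lt.
move=> y xy; split; [apply: He|apply: Hr].
  by have := Rmin_l e r; lra.
by have := Rmin_r e r; lra.
Qed.

(** Otherwise each point has a ball free of terms of [s] from some index on. Finitely many such
    balls cover [X], and the term at the largest of their indices lies in none. *)
Lemma cluster_point (s : nat -> X) :
  exists x, forall e N, 0 < e -> exists n, (N <= n)%nat /\ d (s n) x < e.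
Proof.
apply: contrapT => nex.
have H x : exists eN : R * nat, 0 < eN.1 /\
    forall n, (eN.2 <= n)%nat -> ~ d (s n) x < eN.1.
  apply: contrapT => nH; apply: nex; exists x => e N e0; apply: contrapT => nn.
  apply: nH; exists (e, N); split=> // n Nn sn; apply: nn; by exists n.
have [f Hf] := choice H.
have [_ Hc] := HX.
have [||l Hl] := Hc X (fun x y => d x y < (f x).1).
- by move=> x; exact: ball_open.
- by move=> x; exists x; rewrite dist_refl; case: (Hf x).
pose M := list_max (map (fun x => (f x).2) l).
have [x [lx]] := Hl (s M); rewrite dist_sym; case: (Hf x) => _; apply.
have /Forall_forall H' := proj1 (list_max_le (map (fun x => (f x).2) l) M) (Nat.le_refl _).
exact/H'/in_map.
Qed.

Lemma limit_along_ultrafilter (p : set_system nat) (s : nat -> X) :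
  UltraFilter p -> exists x, forall e, 0 < e -> p (fun n => d (s n) x < e).
Proof.
move=> pU; apply: contrapT => nex.
have H x : exists e, 0 < e /\ p (fun n => ~ d (s n) x < e).
  apply: contrapT => nH; apply: nex; exists x => e e0.
  case: (in_ultra_setVsetC (F := p) (fun n => d (s n) x < e) pU) => // pC.
  by case: nH; exists e.
have [f Hf] := choice H.
have [_ Hc] := HX.
have [||l Hl] := Hc X (fun x y => d x y < f x).
- by move=> x; exact: ball_open.
- by move=> x; exists x; rewrite dist_refl; case: (Hf x).
have : p (fun n => forall x, In x l -> ~ d (s n) x < f x).
  elim: l {Hl} => [|x l IH]; first by apply: (@filterS _ p _ setT) filterT.
  apply: (@filterS _ p) (@filterI _ p _ _ _ IH (proj2 (Hf x))).
  by move=> n [Hn1 Hn2] y [<-//|]; exact: Hn1.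
move=> /(@filter_ex _ p ultra_proper)[n Hn].
by have [x [lx]] := Hl (s n); rewrite dist_sym; exact: Hn.
Qed.

Lemma uniformly_continuous f e : continuous_map d f -> 0 < e ->
  exists r, 0 < r /\ forall x y, d x y < r -> d (f x) (f y) < e.
Proof.
move=> fc e0; apply: contrapT => nex.
have H (n : nat) : exists xy : X * X, d xy.1 xy.2 < / INR (S n) /\ ~ d (f xy.1) (f xy.2) < e.
  have n0 := inv_INR_S_pos n.
  apply: contrapT => nH; apply: nex; exists (/ INR (S n)); split=> // x y xy.
  by apply: contrapT => nxy; apply: nH; exists (x, y).
have [s Hs] := choice H.
have [x Hx] := cluster_point (fun n => (s n).1).
have [r [r0 Hr]] := fc x (e / 2) ltac:(lra).
have [N HN] := @inv_INR_S_small (r / 2) ltac:(lra).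
have [n [Nn Hn]] := Hx (r / 2) N ltac:(lra).
have [Hn1] := Hs n; apply.
have H1 : d x (s n).1 < r by rewrite dist_sym; lra.
have H2 := HN n Nn.
have H3 : d x (s n).2 < r.
  by have := dist_tri (s n).1 x (s n).2; rewrite (dist_sym x (s n).1); lra.
have := dist_tri (f x) (f (s n).1) (f (s n).2).
by rewrite (dist_sym (f (s n).1) (f x)); have := Hr _ H1; have := Hr _ H3; lra.
Qed.

(** * Iterates and proximality *)

Variable T : X -> X.
Hypothesis HT : continuous_map d T.

Lemma itr_add n m x : itr T (n + m) x = itr T n (itr T m x).
Proof. by elim: n => //= n ->. Qed.

Lemma itr_comm n x : itr T n (T x) = T (itr T n x).
Proof. by elim: n => //= n ->. Qed.

Lemma itr_continuous n : continuous_map d (itr T n).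
Proof.
elim: n => [x e e0|n IH x e e0]; first by exists e.
have [r [r0 Hr]] := HT (itr T n x) e0; have [q [q0 Hq]] := IH x r r0.
by exists q; split=> // y /Hq /Hr.
Qed.

Lemma itr_surjective n : surjective_map T -> surjective_map (itr T n).
Proof.
move=> Ts; elim: n => [y|n IH y]; first by exists y.
by have [x <-] := Ts y; have [z <-] := IH x; exists z.
Qed.

Lemma itr_equicontinuous N e : 0 < e ->
  exists r, 0 < r /\ forall n x y, (n <= N)%nat -> d x y < r ->
    d (itr T n x) (itr T n y) < e.
Proof.
move=> e0; elim: N => [|N [r [r0 Hr]]].
  by exists e; split=> // n x y n0; have -> : n = 0%nat by lia.
have [q [q0 Hq]] := uniformly_continuous (@itr_continuous (S N)) e0.
exists (Rmin r q); split; first exact: Rmin_glb_lt.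
move=> n x y nN xy; case: (Nat.eq_dec n (S N)) => [->|ne].
  by apply: Hq; have := Rmin_r r q; lra.
by apply: Hr; [lia|have := Rmin_l r q; lra].
Qed.

Lemma proximal_refl x : proximal d T x x.
Proof. by move=> e e0; exists 0%nat; rewrite dist_refl. Qed.

Lemma proximal_sym x y : proximal d T x y -> proximal d T y x.
Proof. by move=> P e /P[n Hn]; exists n; rewrite dist_sym. Qed.

Lemma proximal_itr n x y :
  proximal d T (itr T n x) (itr T n y) -> proximal d T x y.
Proof. by move=> P e /P[m Hm]; exists (m + n)%nat; rewrite !itr_add. Qed.

Lemma proximal_step x y : proximal d T x y -> proximal d T (T x) (T y).
Proof.
move=> P e /(uniformly_continuous HT)[r [/P[n Hn] Hr]].
by exists n; rewrite !itr_comm; exact: Hr.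
Qed.

(** * Visiting times and semi-openness of minimal maps *)

Hypothesis Hmin : minimal d T.

Lemma minimal_visit (U : X -> Prop) x :
  metric_open d U -> (exists u, U u) -> exists n, U (itr T n x).
Proof. by move=> Uo Une; have [z [Uz [n E]]] := Hmin x Uo Une; exists n; rewrite -E. Qed.

Lemma minimal_visit_ball x y e : 0 < e -> exists n, d y (itr T n x) < e.
Proof.
move=> e0; apply: (minimal_visit (U := fun z => d y z < e)).
  exact: ball_open.
by exists y; rewrite dist_refl.
Qed.

Lemma bounded_visit (U : X -> Prop) : metric_open d U -> (exists u, U u) ->
  exists N, forall x, exists n, (n <= N)%nat /\ U (itr T n x).
Proof.
move=> Uo Une; have [_ Hc] := HX.
have [||l Hl] := Hc nat (fun n x => U (itr T n x)).
- by move=> n; apply: preimage_open Uo; exact: itr_continuous.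
- by move=> x; exact: minimal_visit.
exists (list_max l) => x; have [n [ln Un]] := Hl x; exists n; split=> //.
by have /Forall_forall := proj1 (list_max_le l _) (Nat.le_refl _); apply.
Qed.

(* The complement of [U] is a proper closed set; if its image were all of [X],
   backward orbits inside it would contradict bounded visiting times to [U]. *)
Lemma image_nonempty_interior (U : X -> Prop) : surjective_map T ->
  metric_open d U -> (exists u, U u) ->
  exists V, [/\ metric_open d V, (exists v, V v) &
    forall v, V v -> exists u, U u /\ T u = v].
Proof.
move=> Ts Uo Une; exists (fun y => forall x, T x = y -> U x); split.
- move=> y Hy; apply: contrapT => nex.
  have H (n : nat) : exists x, d y (T x) < / INR (S n) /\ ~ U x.
    have n0 := inv_INR_S_pos n.
    apply: contrapT => nH; apply: nex; exists (/ INR (S n)); split=> // z yz x xz.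
    by apply: contrapT => nU; apply: nH; exists x; rewrite xz.
  have [s Hs] := choice H.
  have [x Hx] := cluster_point s.
  have nU : ~ U x.
    move=> /Uo[e [e0 He]]; have [n [_ Hn]] := Hx e 0%nat e0.
    by have [_] := Hs n; apply; apply: He; rewrite dist_sym.
  apply: nU; apply: Hy; apply: dist_eq0; apply: contrapT => ne.
  have e0 : 0 < d (T x) y by have := dist_ge0 (T x) y; lra.
  have [r [r0 Hr]] := @HT x (d (T x) y / 2) ltac:(lra).
  have [N HN] := @inv_INR_S_small (d (T x) y / 2) ltac:(lra).
  have [n [Nn]] := Hx r N r0; rewrite dist_sym => /Hr Hn; have [yn _] := Hs n.
  have H2 := HN n Nn.
  by have := dist_tri (T (s n)) (T x) y; rewrite (dist_sym (T (s n)) y); lra.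
- apply: contrapT => nex.
  have H y : exists x, T x = y /\ ~ U x.
    apply: contrapT => nH; apply: nex; exists y => x xy.
    by apply: contrapT => nU; apply: nH; exists x.
  have [g Hg] := choice H.
  have [N HN] := bounded_visit Uo Une; have [u _] := Une.
  (* [g] is a right inverse of [T] avoiding [U]. After [n <= N] steps the orbit of [itr g (S N) u]
     is at [itr g (S (N - n)) u], still a value of [g], so it has not met [U]. *)
  have [n [nN]] := HN (itr g (S N) u).
  have E m k : itr T m (itr g (m + k) u) = itr g k u.
    elim: m k => // m IH k; rewrite /= -itr_comm.
    by have [-> _] := Hg (itr g (m + k) u).
  have -> : (S N) = (n + S (N - n))%nat by lia.
  by rewrite E /=; case: (Hg (itr g (N - n) u)).
- by move=> v Hv; have [x xv] := Ts v; exists x; split=> //; apply: Hv.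
Qed.

Lemma itr_image_nonempty_interior n (U : X -> Prop) : surjective_map T ->
  metric_open d U -> (exists u, U u) ->
  exists V, [/\ metric_open d V, (exists v, V v) &
    forall v, V v -> exists u, U u /\ itr T n u = v].
Proof.
move=> Ts Uo Une; elim: n => [|n [V [Vo Vne HV]]].
  by exists U; split=> // v Uv; exists v.
have [W [Wo Wne HW]] := image_nonempty_interior Ts Vo Vne.
exists W; split=> // w /HW[v [/HV[u [Uu <-]] <-]]; by exists u.
Qed.

(** * Condition (2) and rigid points *)

Definition proximal_sensitive : Prop :=
  exists del, 0 < del /\ forall U : X -> Prop, metric_open d U -> (exists u, U u) ->
    exists x y, U x /\ proximal d T x y /\ d x y > del.

(** Some point of [U] enters [V] at a time [n <= N], and by semi-openness the image of [U] under
    [itr T n] contains an open [W] inside [V]. A pair found in [W] lifts through [itr T n]: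
    proximality passes to the lift, and equicontinuity of the first [N] iterates bounds its distance
    below. *)
Lemma proximal_sensitive_local (V : X -> Prop) del : surjective_map T ->
  metric_open d V -> (exists v, V v) -> 0 < del ->
  (forall W : X -> Prop, metric_open d W -> (exists w, W w) ->
    (forall w, W w -> V w) ->
    exists x y, W x /\ proximal d T x y /\ d x y > del) ->
  proximal_sensitive.
Proof.
move=> Ts Vo Vne del0 HV.
have [N HN] := bounded_visit Vo Vne.
have [r [r0 Hr]] := @itr_equicontinuous N del del0.
exists (r / 2); split; first lra.
move=> U Uo [u Uu]; have [n [nN Vn]] := HN u.
have [||W [Wo Wne HW]] := @itr_image_nonempty_interior n (fun z => U z /\ V (itr T n z)) Ts.
- by apply: open_and => //; apply: preimage_open Vo; exact: itr_continuous.
- by exists u.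
have [|x [y [Wx [xy dxy]]]] := HV W Wo Wne.
  by move=> w /HW[z [[_ Vz] <-]].
have [a [[Ua _] ax]] := HW _ Wx; have [b yb] := itr_surjective n Ts y.
exists a, b; split=> //; split; first by apply: (@proximal_itr n); rewrite ax yb.
apply: contrapT => ab; have := Hr n a b nN ltac:(lra); rewrite ax yb; lra.
Qed.

(** Upper semicontinuity at [x0] of the proximal cell, with the cell of [x0] reduced to a point. *)
Definition proximally_rigid (x0 : X) : Prop :=
  forall e, 0 < e -> exists r, 0 < r /\
    forall x y, d x0 x < r -> proximal d T x y -> d x0 y < e.

(* Negating the local criterion at every scale gives nested balls on which
   proximal pairs get arbitrarily close; their common point is rigid. *)
Lemma proximally_rigid_exists : inhabited X -> surjective_map T ->
  ~ proximal_sensitive -> exists x0, proximally_rigid x0.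
Proof.
move=> [a] Ts nS.
(* A state is a step count, a centre and a radius. The next closed ball lies in the present open
   ball, so a cluster point of the centres stays in every ball. *)
have H (c : (nat * (X * R))) : exists b : nat * (X * R), b.1 = S c.1 /\ (0 < c.2.2 -> [/\ 0 < b.2.2,
    forall x, d b.2.1 x <= b.2.2 -> d c.2.1 x < c.2.2 &
    forall x y, d b.2.1 x < b.2.2 -> proximal d T x y -> d x y <= / INR (S c.1)]).
  case: c => k [c r] /=; case: (pselect (0 < r)) => r0; last by exists (S k, (c, r)).
  have k0 := inv_INR_S_pos k.
  apply: contrapT => nex; apply: nS.
  apply: (@proximal_sensitive_local (fun x => d c x < r) (/ INR (S k))) => //.
  - exact: ball_open.
  - by exists c; rewrite dist_refl.
  move=> W Wo [w Ww] WV; apply: contrapT => nW; apply: nex.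
  have [e [e0 He]] := Wo w Ww.
  exists (S k, (w, e / 2)); split=> // _; split=> /=; first lra.
  - by move=> x wx; apply/WV/He; lra.
  - move=> x y wx xy; apply: Rnot_lt_le => dxy; apply: nW; exists x, y.
    by split; [apply: He; lra|split].
have [f Hf] := choice H.
pose b n := Nat.iter n f (0%nat, (a, 1)).
have b1 n : (b n).1 = n by elim: n => //= n IH; case: (Hf (b n)) => -> _; rewrite IH.
have b0 n : 0 < (b n).2.2.
  by elim: n => [|n IH] /=; [lra|case: (Hf (b n)) => _ /(_ IH)[]].
have bS n x : d (b (S n)).2.1 x <= (b (S n)).2.2 -> d (b n).2.1 x < (b n).2.2.
  by case: (Hf (b n)) => _ /(_ (b0 n))[_ + _]; apply.
have bm n m x : d (b (n + m)%nat).2.1 x <= (b (n + m)%nat).2.2 -> d (b n).2.1 x <= (b n).2.2.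
  elim: m => [|m IH]; first by rewrite Nat.add_0_r.
  by rewrite Nat.add_succ_r => /bS H'; apply: IH; lra.
have [x0 Hx0] := cluster_point (fun n => (b n).2.1).
have x0b n : d (b n).2.1 x0 < (b n).2.2.
  apply: bS; apply: Rnot_lt_le => lt.
  have [m [nm Hm]] := Hx0 (d (b (S n)).2.1 x0 - (b (S n)).2.2) (S n) ltac:(lra).
  have := @bm (S n) (m - S n)%nat (b m).2.1.
  have -> : (S n + (m - S n))%nat = m by lia.
  rewrite dist_refl => /(_ ltac:(have := b0 m; lra)).
  by have := dist_tri (b m).2.1 (b (S n)).2.1 x0; lra.
exists x0 => e e0.
have [N HN] := @inv_INR_S_small (e / 2) ltac:(lra).
(* The second bound keeps [x] in the ball of step [S N], where points proximal to [x] are within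
   [/ INR (S N) < e / 2] of it. *)
exists (Rmin (e / 2) ((b (S N)).2.2 - d (b (S N)).2.1 x0)); split.
  by apply: Rmin_glb_lt; [lra|have := x0b (S N); lra].
move=> x y x0x xy.
have H1 := Rmin_l (e / 2) ((b (S N)).2.2 - d (b (S N)).2.1 x0).
have H2 := Rmin_r (e / 2) ((b (S N)).2.2 - d (b (S N)).2.1 x0).
have : d x y <= / INR (S N).
  have [_ /(_ (b0 N))[_ _ H3]] := Hf (b N); rewrite b1 in H3; apply: H3 => //.
  change (d (b (S N)).2.1 x < (b (S N)).2.2).
  by have := dist_tri x0 (b (S N)).2.1 x; lra.
have := HN N (Nat.le_refl N).
by have := dist_tri x x0 y; lra.
Qed.

Section Rigid.
Variable x0 : X.
Hypothesis Hx0 : proximally_rigid x0.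

Lemma rigid_proximal_eq y : proximal d T x0 y -> y = x0.
Proof.
move=> P; apply/esym/dist_eq0; apply: contrapT => ne.
have ge0 := dist_ge0 x0 y.
have [r [r0 Hr]] := @Hx0 (d x0 y) ltac:(lra).
by have := Hr x0 y; rewrite dist_refl => /(_ r0 P); lra.
Qed.

(* Drive [x] close to [x0] by minimality; everything proximal to [x] follows. *)
Lemma rigid_proximal_trans x y z :
  proximal d T x y -> proximal d T y z -> proximal d T x z.
Proof.
move=> xy yz e e0.
have [r [r0 Hr]] := @Hx0 (e / 2) ltac:(lra).
have [q [q0 Hq]] := @Hx0 r r0.
have m0 : 0 < Rmin q (e / 2) by apply: Rmin_glb_lt; lra.
have [n Hn] := minimal_visit_ball x x0 m0; exists n.
have H1 := Rmin_l q (e / 2); have H2 := Rmin_r q (e / 2).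
have P a b k : proximal d T a b -> proximal d T (itr T k a) (itr T k b).
  by move=> ab; elim: k => // k; exact: proximal_step.
have xn : d x0 (itr T n x) < q by lra.
have := Hr _ _ (Hq _ _ xn (P _ _ n xy)) (P _ _ n yz).
by have := dist_tri x0 (itr T n x) (itr T n z); rewrite (dist_sym _ x0); lra.
Qed.

(** Choose [n] with [itr T n x] near [x0]. If a proximal pair [(x', y')] is close enough to
    [(x, y)], then [itr T n x'] is near [x0], rigidity brings [itr T n y'] there too, and
    [itr T n y] is close to it. *)
Lemma rigid_proximal_closed : closed_rel d (proximal d T).
Proof.
move=> x y nP; apply: contrapT => nex; apply: nP => e e0.
have [r [r0 Hr]] := @Hx0 (e / 3) ltac:(lra).
have m0 : 0 < Rmin (r / 2) (e / 3) by apply: Rmin_glb_lt; lra.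
have [n Hn] := minimal_visit_ball x x0 m0; exists n.
have H1 := Rmin_l (r / 2) (e / 3); have H2 := Rmin_r (r / 2) (e / 3).
have [q [q0 Hq]] := @itr_equicontinuous n _ m0.
apply: contrapT => far; apply: nex; exists q; split=> // x' y' xx' yy' P.
apply: far.
have P' : proximal d T (itr T n x') (itr T n y').
  by elim: n {Hn Hq} => // k; exact: proximal_step.
have Hx := Hq n _ _ (Nat.le_refl n) xx'; have Hy := Hq n _ _ (Nat.le_refl n) yy'.
have xn : d x0 (itr T n x') < r by have := dist_tri (itr T n x) x0 (itr T n x'); lra.
have := Hr _ _ xn P'; rewrite (dist_sym (itr T n y)) in Hy.
have := dist_tri x0 (itr T n x) (itr T n y); rewrite (dist_sym _ x0).
by have := dist_tri (itr T n y') x0 (itr T n y); lra.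
Qed.

Lemma rigid_distal_rel x y : distal_rel d T x y -> proximal d T x y.
Proof.
apply=> //.
- split; first exact: proximal_refl.
  by split; [exact: proximal_sym|exact: rigid_proximal_trans].
- exact: rigid_proximal_closed.
- exact: proximal_step.
Qed.

(** A point in the class of [itr T n x0] is some [itr T n z] proximal to it; then [z] is proximal to
    [x0], hence equal to it. *)
Lemma rigid_almost_one_to_one : surjective_map T -> pi_almost_one_to_one d T.
Proof.
move=> Ts U Uo Une; have [n Un] := minimal_visit x0 Uo Une.
exists (itr T n x0); split=> // y /rigid_distal_rel.
have [z <-] := itr_surjective n Ts y.
by move=> /proximal_itr /rigid_proximal_eq ->.
Qed.

End Rigid.

(** * From (2) to (3) *)

Lemma distal_rel_limit (u v : nat -> X) x y :
  (forall n, distal_rel d T (u n) (v n)) ->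
  (forall e, 0 < e -> exists n, d x (u n) < e /\ d y (v n) < e) ->
  distal_rel d T x y.
Proof.
move=> uv H Rl Req Rcl Rinv RP; apply: contrapT => /Rcl[e [e0 He]].
by have [n [xu yv]] := H e e0; apply: (He _ _ xu yv); exact: uv.
Qed.

(** Let [x0] have a singleton class and take proximal pairs more than [del] apart whose first points
    tend to [x0]. A cluster point of the second points is in the class of [x0], so it is [x0], which
    contradicts the distance. *)
Lemma almost_one_to_one_not_proximal_sensitive : inhabited X ->
  pi_almost_one_to_one d T -> ~ proximal_sensitive.
Proof.
move=> [a] A [del [del0 Hdel]].
have [||x0 [_ Hx0]] := A (fun=> True); [|by exists a|].
  by move=> x _; exists 1; split=> //; lra.
have H (n : nat) : exists xy : X * X,
    [/\ d x0 xy.1 < / INR (S n), distal_rel d T xy.1 xy.2 & d xy.1 xy.2 > del].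
  have n0 := inv_INR_S_pos n.
  have [||x [y [xn [xy dxy]]]] := Hdel (fun x => d x0 x < / INR (S n)).
  - exact: ball_open.
  - by exists x0; rewrite dist_refl.
  exists (x, y); split=> //; move=> Rl _ _ _; exact.
have [s Hs] := choice H.
have [y Hy] := cluster_point (fun n => (s n).2).
have near e : 0 < e -> exists n, d x0 (s n).1 < e /\ d y (s n).2 < e.
  move=> e0; have [N HN] := @inv_INR_S_small _ e0.
  have [n [Nn Hn]] := Hy e N e0; exists n; rewrite (dist_sym y); split=> //.
  have [Hn1 _ _] := Hs n.
  by have := HN n Nn; lra.
have yx0 : y = x0.
  apply: Hx0; apply: (distal_rel_limit (u := fun n => (s n).1) (v := fun n => (s n).2)) => //.
  by move=> n; case: (Hs n).
have [n [H1 H2]] := near (del / 2) ltac:(lra); have [_ _ H3] := Hs n.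
by have := dist_tri x0 (s n).1 (s n).2; rewrite (dist_sym (s n).1 x0); rewrite yx0 in H2; lra.
Qed.

(** * From (2) to (1) *)

(** Once the two orbits are close enough, they stay close until that of [y] visits the ball around
    [y]. One extra application of [T] makes the time positive. *)
Lemma proximal_return x y e : proximal d T x y -> 0 < e ->
  exists n, [/\ (0 < n)%nat, d y (itr T n x) < e & d y (itr T n y) < e].
Proof.
move=> xy e0.
have [||N HN] := @bounded_visit (fun z => d y z < e / 2).
- exact: ball_open.
- by exists y; rewrite dist_refl; lra.
have [r [r0 Hr]] := @itr_equicontinuous (S N) (e / 2) ltac:(lra).
have [m Hm] := xy r r0.
have [n [nN Hn]] := HN (T (itr T m y)).
rewrite itr_comm in Hn; change (d y (itr T (S n) (itr T m y)) < e / 2) in Hn.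
exists (S n + m)%nat; rewrite !itr_add.
have := Hr (S n) _ _ ltac:(lia) Hm; rewrite dist_sym.
split; [lia| |lra].
by have := dist_tri (itr T (S n) (itr T m y)) y (itr T (S n) (itr T m x)); lra.
Qed.

(* The radii shrink so that [T^(p i)] maps the [i+1]-st ball into the [i]-th;
   a finite sum is then followed by applying the largest index first. *)
Lemma proximal_IP_return x y e : proximal d T x y -> 0 < e ->
  exists p : nat -> nat, (forall i, (0 < p i)%nat) /\
    forall alpha : list nat, alpha <> nil -> NoDup alpha ->
      d y (itr T (sum_over p alpha) x) < e /\ d y (itr T (sum_over p alpha) y) < e.
Proof.
move=> xy e0.
have H r : exists nq : nat * R, 0 < r -> [/\ (0 < nq.1)%nat, 0 < nq.2, nq.2 <= r,
    d y (itr T nq.1 x) < r /\ d y (itr T nq.1 y) < r &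
    forall w, d y w < nq.2 -> d y (itr T nq.1 w) < r].
  case: (pselect (0 < r)) => r0; last by exists (0%nat, 0).
  have [n [n0 nx ny]] := proximal_return xy r0.
  have [q [q0 Hq]] := @itr_continuous n y (r - d y (itr T n y)) ltac:(lra).
  exists (n, Rmin q r) => _ /=; split=> //; [exact: Rmin_glb_lt|exact: Rmin_r|].
  move=> w yw; have := Rmin_l q r => qr.
  by have := Hq w ltac:(lra); have := dist_tri (itr T n y) y (itr T n w); lra.
have [f Hf] := choice H.
pose rho n := Nat.iter n (fun r => (f r).2) e.
have rho0 n : 0 < rho n by elim: n => //= n IH; case: (Hf (rho n) IH).
pose p n := (f (rho n)).1.
exists p; split=> [i|alpha ne nd]; first by case: (Hf _ (rho0 i)).
suff main N j (l : list nat) : l <> nil -> NoDup l ->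
    (forall i, In i l -> (j <= i < j + N)%nat) ->
    d y (itr T (sum_over p l) x) < rho j /\ d y (itr T (sum_over p l) y) < rho j.
  apply: (main (S (list_max alpha)) 0%nat) => // i ia.
  have /Forall_forall/(_ _ ia) := proj1 (list_max_le alpha _) (Nat.le_refl _); lia.
(* Induction on the length of the index window from [j] to [j + N]. The index [j], if present, is
   split off and its iterate applied last. *)
elim: N j l => [j [//|i l] _ _ /(_ i (or_introl erefl))|N IH j l lne lnd lj]; first lia.
have [_ _ rj [Hx Hy] Hw] := Hf _ (rho0 j).
have [jl|njl] := pselect (In j l); last first.
  have [|H1 H2] := IH (S j) l lne lnd.
    move=> i il; have := lj i il; have : i <> j by move=> ij; rewrite ij in il.
    lia.
  by change (rho (S j)) with (f (rho j)).2 in H1, H2; lra.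
have [l1 [l2 E]] := in_split _ _ jl; rewrite E in lnd lj.
have [nd' nj] := NoDup_remove _ _ _ lnd.
have {E}-> : sum_over p l = (p j + sum_over p (l1 ++ l2)%list)%nat.
  by rewrite E !sum_over_app /=; lia.
case: (pselect ((l1 ++ l2)%list = nil)) => [->|lne']; first by rewrite /= Nat.add_0_r.
have [|H1 H2] := IH (S j) (l1 ++ l2)%list lne' nd'.
  move=> i il; have /lj : In i (l1 ++ j :: l2)%list.
    by move: il; rewrite !in_app_iff /=; tauto.
  have : i <> j by move=> ij; rewrite ij in il.
  lia.
by rewrite !itr_add; split; exact: Hw.
Qed.

Lemma proximal_sensitive_strongly :
  proximal_sensitive -> strongly_sensitive d T F_ip.
Proof.
move=> [del [del0 Hdel]]; exists (del / 4); split; first lra.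
move=> U Uo [u Uu]; have [x [y [Ux [xy dxy]]]] := Hdel U Uo (ex_intro _ u Uu).
have [e [e0 He]] := Uo x Ux.
have m0 : 0 < Rmin e (del / 4) by apply: Rmin_glb_lt; lra.
have [k Hk] := minimal_visit_ball y x m0.
have H1 := Rmin_l e (del / 4); have H2 := Rmin_r e (del / 4).
have [r [r0 Hr]] := @itr_continuous k y (del / 4) ltac:(lra).
have r0' : 0 < Rmin r (del / 4) by apply: Rmin_glb_lt; lra.
have H3 := Rmin_l r (del / 4); have H4 := Rmin_r r (del / 4).
have [p [p0 Hp]] := proximal_IP_return xy r0'.
(* Along the IP-set, [x] moves within [del / 4] of [y], and [itr T k y] returns within [del / 4] of
   itself, hence within [del / 2] of [x]. As [d x y > del], more than [del / 4] remains. *)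
exists x, (itr T k y); split=> //; split; first by apply: He; lra.
exists p; split=> // alpha ne nd; have [Hx Hy] := Hp alpha ne nd.
have := Hr (itr T (sum_over p alpha) y) ltac:(lra).
rewrite -!itr_add Nat.add_comm; set n := sum_over p alpha; rewrite -/n in Hx Hy.
rewrite !itr_add => H5.
have H6 := dist_tri (itr T k y) x y; have H7 := dist_tri (itr T n (itr T k y)) (itr T k y) y.
have H8 := dist_tri (itr T n x) (itr T n (itr T k y)) y.
rewrite (dist_sym (itr T n x) y) in H8.
rewrite (dist_sym (itr T n (itr T k y)) (itr T n x)) in H8.
lra.
Qed.

(** * From (1) to (2) *)

(** Writing [x' = p x], idempotence gives [p x' = p (p x) = x'], so [x] and [x'] come near [x'] at
    common times. *)
Lemma idempotent_limit_proximal (p : set_system nat) x x' :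
  UltraFilter p -> filter_add p p = p ->
  (forall e, 0 < e -> p (fun n => d (itr T n x) x' < e)) -> proximal d T x x'.
Proof.
move=> pU pp Hp e e0; have pF : Filter p by exact: filter_filter.
have A := Hp (e / 2) ltac:(lra).
have A' := A; rewrite -pp in A'.
have [n [Hn An]] := @filter_ex _ p ultra_proper _ (@filterI _ p _ _ _ A A').
have [r [r0 Hr]] := @itr_continuous n x' (e / 2 - d (itr T n x) x') ltac:(lra).
have [m [Hm Am]] := @filter_ex _ p ultra_proper _ (@filterI _ p _ _ _ (Hp r r0) An).
rewrite dist_sym in Hm; have := Hr _ Hm; rewrite itr_add in Am.
exists n; have := dist_tri x' (itr T n x) (itr T n x').
have := dist_tri (itr T n (itr T m x)) x' (itr T n x').
rewrite (dist_sym x' (itr T n (itr T m x))) (dist_sym (itr T n (itr T m x)) (itr T n x')).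
lra.
Qed.

Lemma strongly_sensitive_proximal :
  strongly_sensitive d T F_ip -> proximal_sensitive.
Proof.
move=> [del [del0 Hdel]]; exists (del / 4); split; first lra.
move=> U Uo [u Uu].
have [||x [y [[Ux ux] [[Uy uy] [s [_ Hs]]]]]] := Hdel (fun z => U z /\ d u z < del / 8).
- by apply: open_and => //; exact: ball_open.
- by exists u; rewrite dist_refl; split=> //; lra.
have [p [pU pp Hp]] := IP_idempotent s.
have pxy : p (fun n => d (itr T n x) (itr T n y) > del) := Hp _ Hs.
have [x' Hx'] := limit_along_ultrafilter (itr T ^~ x) pU.
have [y' Hy'] := limit_along_ultrafilter (itr T ^~ y) pU.
have Px := idempotent_limit_proximal pU pp Hx'.
have Py := idempotent_limit_proximal pU pp Hy'.
have far : del <= d x' y'.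
  apply: Rnot_lt_le => lt.
  have pF : Filter p by exact: filter_filter.
  have A := Hx' ((del - d x' y') / 2) ltac:(lra).
  have B := Hy' ((del - d x' y') / 2) ltac:(lra).
  have [n [[Hx Hy] Hxy]] := @filter_ex _ p ultra_proper _
    (@filterI _ p _ _ _ (@filterI _ p _ _ _ A B) pxy).
  have := dist_tri x' (itr T n x) (itr T n y); have := dist_tri y' x' (itr T n y).
  by rewrite (dist_sym y' (itr T n y)); lra.
have xy : d x y < del / 4 by have := dist_tri u x y; rewrite (dist_sym x u); lra.
(* Since [x'] and [y'] are at least [del] apart and [x], [y] less than [del / 4], one of [x], [y] is
   more than [del / 4] from its limit. *)
case: (Rlt_le_dec (del / 4) (d x x')) => xx'; first by exists x, x'.
exists y, y'; split=> //; split=> //.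
by have := dist_tri x x' y'; have := dist_tri y x y'; rewrite (dist_sym x' x); lra.
Qed.
End CompactMetric.

Theorem theorem4p12 (X : Type) (d : X -> X -> R) (T : X -> X)
  (HX : compact_metric_space d) (Hne : inhabited X)
  (HT : continuous_map d T) (Hsurj : surjective_map T)
  (Hmin : minimal d T) :
  (strongly_sensitive d T F_ip <->
   (exists del, 0 < del /\ forall U : X -> Prop, metric_open d U -> (exists u, U u) ->
      exists x y, U x /\ proximal d T x y /\ d x y > del)) /\
  ((exists del, 0 < del /\ forall U : X -> Prop, metric_open d U -> (exists u, U u) ->
      exists x y, U x /\ proximal d T x y /\ d x y > del) <->
   ~ pi_almost_one_to_one d T).
Proof.
have two_three : proximal_sensitive d T -> ~ pi_almost_one_to_one d T.
  by move=> S A; exact: (almost_one_to_one_not_proximal_sensitive HX Hne A S).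
split; split.
- exact: strongly_sensitive_proximal.
- exact: proximal_sensitive_strongly.
- exact: two_three.
- move=> nA; apply: contrapT => nS; apply: nA.
  have [x0 Hx0] := proximally_rigid_exists HX HT Hmin Hne Hsurj nS.
  exact: (rigid_almost_one_to_one HX HT Hmin Hx0 Hsurj).
Qed.
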